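(* $\mathsf{PostR}_{1/3}(MAJ_N) = \Theta(N)$, as $N\to\infty$.
   Context: $MAJ_N:\{0,1\}^N\rightarrow\{0,1\}$ is defined by $MAJ_N(x)=1$ if $|x|>N/2$ and $0$ if $|x|\le N/2$, where $|x|$ is the Hamming weight. $\mathsf{PostR}_\epsilon(f)$ is the minimum query complexity (maximum depth of a tree in the support) of a probability distribution $\mathcal{A}$ over deterministic decision trees with leaves labelled $0$, $1$ or $\perp$, chosen independently of the input, such that for every input $x$, $\Pr[\mathcal{A}(x)\neq\perp]>0$ and $\Pr[\mathcal{A}(x)=f(x)\mid\mathcal{A}(x)\neq\perp]\ge1-\epsilon$. *)

(* Defs.v *)
From HB Require Import structures.
From mathcomp Require Import all_boot all_order all_algebra.
From mathcomp Require Export all_classical all_reals all_analysis.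
Export Order.TTheory GRing.Theory Num.Theory.
Export numFieldNormedType.Exports.

Set Implicit Arguments.
Unset Strict Implicit.
Unset Printing Implicit Defensive.

Local Open Scope classical_set_scope.
Local Open Scope ring_scope.

Definition input (N : nat) := {ffun 'I_N -> bool}.

Definition hamming N (x : input N) : nat := #|[set i | x i]%SET|.

Definition MAJ N (x : input N) : bool := (N < 2 * hamming x)%N.

(* The label [None] stands for the answer "bottom". *)
Inductive dtree (N : nat) : Type :=
| Leaf of option bool
| Query of 'I_N & dtree N & dtree N.

Arguments Leaf {N} _.

Fixpoint depth N (t : dtree N) : nat :=
  if t is Query _ t0 t1 then (maxn (depth t0) (depth t1)).+1 else 0%N.

Fixpoint eval N (t : dtree N) (x : input N) : option bool :=
  match t with
  | Leaf a => a
  | Query i t0 t1 => if x i then eval t1 x else eval t0 x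
  end.

Section dtree_countable.
Variable N : nat.

Fixpoint dtree_encode (t : dtree N) : GenTree.tree (option bool) :=
  match t with
  | Leaf a => GenTree.Leaf a
  | Query i t0 t1 => GenTree.Node i [:: dtree_encode t0; dtree_encode t1]
  end.

Fixpoint dtree_decode (u : GenTree.tree (option bool)) : option (dtree N) :=
  match u with
  | GenTree.Leaf a => Some (Leaf a)
  | GenTree.Node k [:: u0; u1] =>
      match insub k, dtree_decode u0, dtree_decode u1 with
      | Some i, Some t0, Some t1 => Some (Query i t0 t1)
      | _, _, _ => None
      end
  | _ => None
  end.

Lemma dtree_encodeK : pcancel dtree_encode dtree_decode.
Proof. by elim=> [a|i t0 IH0 t1 IH1] //=; rewrite valK IH0 IH1. Qed.

HB.instance Definition _ := Countable.copy (dtree N) (pcan_type dtree_encodeK).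

HB.instance Definition _ := isPointed.Build (dtree N) (Leaf None).

HB.instance Definition _ := @isMeasurable.Build default_measure_display
  (dtree N) discrete_measurable discrete_measurable0
  discrete_measurableC discrete_measurableU.

End dtree_countable.

Section PostR.
Variables (R : realType) (N : nat).

(* [dtree N] is countable and carries the discrete sigma-algebra, so the trees of
   positive mass carry the whole measure. *)
Definition ralg := probability (dtree N) R.

Definition in_support (A : ralg) (t : dtree N) : Prop := (0 < A [set t])%E.

Definition has_complexity (A : ralg) (d : nat) : Prop :=
  (exists2 t, in_support A t & depth t = d) /\
  (forall t, in_support A t -> (depth t <= d)%N).

Definition Pr (A : ralg) (E : set (dtree N)) : R := fine (A E).

Definition cond_Pr (A : ralg) (E F : set (dtree N)) : R :=
  Pr A (E `&` F) / Pr A F.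

Definition accepted (x : input N) : set (dtree N) := [set t | eval t x <> None].

Definition correct (f : input N -> bool) (x : input N) : set (dtree N) :=
  [set t | eval t x = Some (f x)].

Definition post_computes (eps : R) (f : input N -> bool) (A : ralg) : Prop :=
  forall x, 0 < Pr A (accepted x) /\
            1 - eps <= cond_Pr A (correct f x) (accepted x).

Definition post_complexities (eps : R) (f : input N -> bool) : set nat :=
  [set d | exists2 A, post_computes eps f A & has_complexity A d].

(* The minimum of [post_complexities eps f]; the default value 0 is returned
   only if no algorithm of bounded depth exists, which by [PostR_min] does not
   happen for nonnegative [eps]. *)
Definition PostR (eps : R) (f : input N -> bool) : nat :=
  get [set d | post_complexities eps f d /\ lbound (post_complexities eps f) d].

Fixpoint full_tree (f : input N -> bool) (s : seq 'I_N) (y : input N) : dtree N :=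
  if s is i :: s' then
    Query i (full_tree f s' [ffun j => if j == i then false else y j])
            (full_tree f s' [ffun j => if j == i then true else y j])
  else Leaf (Some (f y)).

Lemma eval_full_tree f s (y x : input N) :
  eval (full_tree f s y) x =
    Some (f [ffun j => if j \in s then x j else y j]).
Proof.
elim: s y => [|i s IH] y /=.
  by congr (Some (f _)); apply/ffunP => j; rewrite ffunE.
case: ifP => xi; rewrite IH; congr (Some (f _)); apply/ffunP => j;
  rewrite !ffunE inE; case: (eqVneq j i) => [->|_] /=; by rewrite ?xi ?if_same.
Qed.

Lemma post_complexities_neq0 eps f : 0 <= eps ->
  post_complexities eps f !=set0.
Proof.
move=> eps0; pose t := full_tree f (enum 'I_N) [ffun=> false].
have tE x : eval t x = Some (f x).
  rewrite eval_full_tree; congr (Some (f _)); apply/ffunP => j.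
  by rewrite ffunE mem_enum.
pose A : ralg := dirac t.
have AE E : A E = (t \in E)%:R%:E by exact: diracE.
have supp u : in_support A u -> u = t.
  rewrite /in_support AE.
  by case: (boolP (t \in [set u])) => [/set_mem/= ->//|]; rewrite ltxx.
exists (depth t); exists A.
- move=> x; have at1 E : E t -> Pr A E = 1.
    by move=> Et; rewrite /Pr AE mem_set.
  have acc : accepted x t by rewrite /accepted /= tE.
  rewrite /cond_Pr !at1 //; last by split=> //; rewrite /correct /= tE.
  by rewrite ltr01 divr1 lerBlDr lerDl.
- split; last by move=> u /supp ->.
  by exists t => //; rewrite /in_support AE mem_set //= lte_fin ltr01.
Qed.

Lemma PostR_min eps f : 0 <= eps ->
  post_complexities eps f (PostR eps f) /\
  lbound (post_complexities eps f) (PostR eps f).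
Proof.
move=> /(post_complexities_neq0 f) [d0 d0P].
pose Q := [set d | post_complexities eps f d /\ lbound (post_complexities eps f) d].
suff : exists d, Q d by move=> /getPex.
have ex : exists d, `[< post_complexities eps f d >].
  by exists d0; apply/asboolP.
case: (ex_minnP ex) => m /asboolP mP mle; exists m; split => // d dP.
by rewrite leEnat; apply: mle; apply/asboolP.
Qed.

End PostR.

(* Main.v *)
(* Let K_a(w) be the sum over the inputs x of weight w of Pr[A(x) = a]. Flipping
   one bit of x changes the answer of a tree of depth d for at most d positions,
   so counting the edges of the cube between weights w and w+1 on which a tree
   answers a at both ends, once from below and once from above, gives
     K_a(w) (N-w-d) <= K_a(w+1) (w+1)   and   K_a(w+1) (w+1-d) <= K_a(w) (N-w).
   At w = floor(N/2) the odds of answer 1 against answer 0 must rise from at most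
   1/2 to at least 2, whence 4 (N-w-d) (w+1-d) <= (N-w) (w+1), which forces
   N <= 8d. Querying every bit gives the matching upper bound N. *)
Require Import Defs.
From mathcomp Require Import all_boot all_order all_algebra.
From mathcomp Require Import all_classical all_reals all_analysis.
From mathcomp Require Import zify lra.

Set Implicit Arguments.
Unset Strict Implicit.
Unset Printing Implicit Defensive.

Local Open Scope classical_set_scope.
Local Open Scope ring_scope.

(* [all_analysis] shadows the evaluation of decision trees. *)
Local Notation eval := Defs.eval.

(** * Bit flips and the sensitivity of decision trees *)

Definition flip N (x : input N) (i : 'I_N) : input N :=
  [ffun j => if j == i then ~~ x j else x j].

Lemma flipK N (i : 'I_N) : involutive (fun x : input N => flip x i).
Proof.
by move=> x; apply/ffunP => j; rewrite !ffunE; case: eqP => // _; rewrite negbK.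
Qed.

Lemma hammingE N (x : input N) : hamming x = (\sum_i x i)%N.
Proof.
rewrite /hamming -sum1_card big_mkcond /=; apply: eq_bigr => i _.
by rewrite inE; case: (x i).
Qed.

Lemma sum_negb_hamming N (x : input N) : (\sum_i ~~ x i = N - hamming x)%N.
Proof.
have : ((\sum_i ~~ x i) + hamming x = N)%N.
  rewrite hammingE -big_split /= -[RHS]card_ord -sum1_card.
  by apply: eq_bigr => i _; case: (x i).
lia.
Qed.

Lemma hamming_flip N (x : input N) i :
  ~~ x i -> hamming (flip x i) = (hamming x).+1.
Proof.
move=> xi; rewrite !hammingE (bigD1 i) //= [in RHS](bigD1 i) //=.
rewrite ffunE eqxx xi (negbTE xi) add0n add1n; congr _.+1.
by apply: eq_bigr => j ji; rewrite ffunE (negbTE ji).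
Qed.

(** Flipping a bit other than the one queried at the root leaves the input in the same subtree, so
    each query on the path adds at most one sensitive position. *)
Lemma sensitivity_le_depth N (t : dtree N) (x : input N) :
  (\sum_i (eval t (flip x i) != eval t x) <= depth t)%N.
Proof.
elim: t => [a|j t0 IH0 t1 IH1]; first by rewrite big1 // => i _ /=; rewrite eqxx.
have sub (t : dtree N) : (forall i, i != j ->
      eval (Query j t0 t1) (flip x i) = eval t (flip x i)) ->
    eval (Query j t0 t1) x = eval t x ->
    (\sum_i (eval t (flip x i) != eval t x) <= maxn (depth t0) (depth t1))%N ->
    (\sum_i (eval (Query j t0 t1) (flip x i) != eval (Query j t0 t1) x)
      <= (maxn (depth t0) (depth t1)).+1)%N.
  move=> tE txE le; rewrite -add1n (bigD1 j) //=; apply: leq_add.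
    exact: leq_b1.
  apply: leq_trans le; rewrite [leqRHS](bigD1 j) //=; apply: leq_trans (leq_addl _ _).
  by apply: leq_sum => i ij; rewrite -txE -tE.
case xj: (x j).
- apply: (sub t1) => [i ij||] /=; rewrite ?xj //.
    by rewrite ffunE eq_sym (negbTE ij) xj.
  exact: leq_trans IH1 (leq_maxr _ _).
- apply: (sub t0) => [i ij||] /=; rewrite ?xj //.
    by rewrite ffunE eq_sym (negbTE ij) xj.
  exact: leq_trans IH0 (leq_maxl _ _).
Qed.

Lemma insensitive_count N (t : dtree N) (x : input N) (P : pred 'I_N) :
  (\sum_i P i - depth t <= \sum_i (P i && (eval t (flip x i) == eval t x)))%N.
Proof.
rewrite leq_subLR; apply: leq_trans (leq_add (sensitivity_le_depth t x) (leqnn _)).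
rewrite -big_split /=; apply: leq_sum => i _.
by case: (P i); case: (_ == _).
Qed.

(** * Double counting of edges between adjacent levels of the cube *)

Definition level_count N (g : input N -> option bool) (a : option bool)
    (w : nat) : nat :=
  (\sum_(x | hamming x == w) (g x == a))%N.

(** Each edge is counted once, at its lower endpoint, with [i] as its direction. *)
Definition flat_edges N (g : input N -> option bool) (a : option bool)
    (w : nat) : nat :=
  (\sum_(x | hamming x == w) \sum_i
     ((g x == a) && (~~ x i && (g (flip x i) == a))))%N.

(** The same edges seen from their upper endpoints: for each fixed direction [i], substitute
    [flip y i] for the lower endpoint. *)
Lemma flat_edgesE N (g : input N -> option bool) a w :
  flat_edges g a w = (\sum_(y | hamming y == w.+1) \sum_i
     ((g y == a) && (y i && (g (flip y i) == a))))%N.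
Proof.
rewrite /flat_edges exchange_big [RHS]exchange_big /=; apply: eq_bigr => i _.
rewrite (reindex_inj (inv_inj (flipK i))) /= big_mkcond [RHS]big_mkcond /=.
apply: eq_bigr => y _; rewrite flipK ffunE eqxx negbK.
have [yi|/negbTE yi] := boolP (y i); last first.
  by rewrite !andbF /= !if_same.
have -> : hamming y = (hamming (flip y i)).+1.
  by rewrite -(@hamming_flip _ (flip y i) i) ?flipK // ffunE eqxx yi.
by rewrite eqSS /= andbC.
Qed.

(** A lower endpoint answering [a] has [N - w] upward edges, all but [depth t] of them flat; an
    upper endpoint has only [w.+1] downward edges. Subtraction is truncated, so deep trees satisfy
    this trivially. *)
Lemma level_count_up N (t : dtree N) a w :
  (level_count (eval t) a w * (N - w - depth t)
    <= level_count (eval t) a w.+1 * w.+1)%N.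
Proof.
apply: (@leq_trans (flat_edges (eval t) a w)).
  rewrite /level_count big_distrl /=; apply: leq_sum => x /eqP <-.
  case: eqP => [<-|_]; last by rewrite mul0n.
  rewrite mul1n -sum_negb_hamming.
  exact: (insensitive_count t x (fun i => ~~ x i)).
rewrite flat_edgesE /level_count big_distrl /=; apply: leq_sum => y /eqP <-.
case: eqP => [_|_]; last by rewrite big1.
by rewrite mul1n hammingE; apply: leq_sum => i _; case: (y i); rewrite //= leq_b1.
Qed.

Lemma level_count_down N (t : dtree N) a w :
  (level_count (eval t) a w.+1 * (w.+1 - depth t)
    <= level_count (eval t) a w * (N - w))%N.
Proof.
apply: (@leq_trans (flat_edges (eval t) a w)).
  rewrite flat_edgesE /level_count big_distrl /=; apply: leq_sum => y /eqP <-.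
  case: eqP => [<-|_]; last by rewrite mul0n.
  rewrite mul1n {1}hammingE; exact: (insensitive_count t y y).
rewrite /level_count big_distrl /=; apply: leq_sum => x /eqP <-.
case: eqP => [_|_]; last by rewrite big1.
rewrite mul1n -sum_negb_hamming; apply: leq_sum => i _.
by case: (x i); rewrite //= leq_b1.
Qed.

(** * Averaging over the distribution of trees *)

Section Probability.
Context {R : realType} {N : nat} (A : ralg R N).

(** There are infinitely many trees but finitely many behaviours, so grouping trees by behaviour
    turns integrals over trees into finite sums. *)
Definition behaviour (t : dtree N) : {ffun input N -> option bool} :=
  [ffun x => eval t x].

Lemma level_count_behaviour t a w :
  level_count (behaviour t) a w = level_count (eval t) a w.
Proof. by apply: eq_bigr => x _; rewrite ffunE. Qed.

Lemma Pr_ge0 (E : set (dtree N)) : 0 <= Pr A E.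
Proof. by rewrite fine_ge0. Qed.

Lemma Pr_behaviour (P : pred {ffun input N -> option bool}) :
  Pr A [set t | P (behaviour t)] =
  \sum_(phi | P phi) Pr A [set t | behaviour t = phi].
Proof.
rewrite /Pr; have -> : [set t | P (behaviour t)] =
    \bigcup_(phi in [set` P]) [set t | behaviour t = phi].
  apply/seteqP; split=> t /=; first by move=> Pt; exists (behaviour t).
  by case=> phi Pphi /= ->.
rewrite measure_fin_bigcup //; last by move=> phi psi _ _ [t [/= <- <-]].
rewrite fsbig_finite //= (perm_big (enum P)) ?big_enum /=; last first.
  apply: uniq_perm; rewrite ?enum_uniq ?finmap.fset_uniq // => phi.
  by rewrite in_fset_set // mem_enum mem_setE.
by rewrite sum_fine // => phi _; exact: fin_num_measure.
Qed.

(** Otherwise [E] would be a countable union of null singletons. This gives access to the depth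
    bound, which is known only on the support. *)
Lemma support_inhab (E : set (dtree N)) : 0 < Pr A E ->
  exists2 t, E t & in_support A t.
Proof.
move=> E0; apply: contrapT => nE; move: E0; rewrite /Pr; suff -> : A E = 0%E by rewrite ltxx.
apply/(measure_negligible (mu := A)) => //.
have -> : E = \bigcup_k (E `&` [set t | pickle t = k]).
  by apply/seteqP; split => [t Et|t [k _ []]//]; exists (pickle t).
apply: negligible_bigcup => k.
have [[t [Et tk]]|] := pselect (exists t, E t /\ pickle t = k).
  have -> : E `&` [set t | pickle t = k] = [set t].
    apply/seteqP; split=> [u /= [_ uk]|u /= ->//].
    by apply: (pcan_inj (@pickleK _)); rewrite uk.
  apply/negligibleP => //; apply/eqP; rewrite eq_le measure_ge0 andbT leNgt.
  by apply/negP => t0; apply: nE; exists t.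
move=> nt; have -> : E `&` [set t | pickle t = k] = set0.
  by apply/seteqP; split=> // u [Eu uk]; case: nt; exists u.
exact: negligible_set0.
Qed.

Definition level_Pr (a : option bool) (w : nat) : R :=
  \sum_(x | hamming x == w) Pr A [set t | eval t x = a].

Lemma level_PrE a w : level_Pr a w =
  \sum_phi Pr A [set t | behaviour t = phi] * (level_count phi a w)%:R.
Proof.
transitivity (\sum_(x : input N | hamming x == w) \sum_phi
    Pr A [set t | behaviour t = phi] * (phi x == a)%:R).
  apply: eq_bigr => x _.
  have -> : [set t | eval t x = a] = [set t | behaviour t x == a].
    by apply/seteqP; split=> t /=; rewrite ffunE => /eqP.
  rewrite (Pr_behaviour (fun phi => phi x == a)) big_mkcond /=.
  by apply: eq_bigr => phi _; case: ifP; rewrite ?mulr1 ?mulr0.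
rewrite exchange_big /=; apply: eq_bigr => phi _.
by rewrite -mulr_sumr natr_sum.
Qed.

(** A behaviour of positive probability is realised by some tree in the support, and level counts
    depend only on the behaviour; the inequality then holds term by term. *)
Lemma level_Pr_mono a b w v (c e : nat) :
  (forall t, in_support A t ->
    level_count (eval t) a w * c <= level_count (eval t) b v * e)%N ->
  level_Pr a w * c%:R <= level_Pr b v * e%:R.
Proof.
move=> le; rewrite !level_PrE !mulr_suml; apply: ler_sum => phi _.
rewrite -!mulrA -!natrM.
have [->|pn0] := eqVneq (Pr A [set t | behaviour t = phi]) 0; first by rewrite !mul0r.
have p0 : 0 < Pr A [set t | behaviour t = phi] by rewrite lt0r pn0 Pr_ge0.
have [t /= <- At] := support_inhab p0.
rewrite !level_count_behaviour !ler_wpM2l ?Pr_ge0 // ler_nat; exact: le.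
Qed.

(** With [p] and [q] the probabilities of the right and wrong answers, [2/3 <= p / (p + q)] means
    [2 * q <= p], and [p + q > 0] then forces [p > 0]. *)
Lemma post_computes_odds f x : post_computes (1 / 3) f A ->
  2 * Pr A [set t | eval t x = Some (~~ f x)] <= Pr A [set t | eval t x = Some (f x)]
  /\ 0 < Pr A [set t | eval t x = Some (f x)].
Proof.
move=> /(_ x) []; rewrite /cond_Pr.
have -> : correct f x `&` accepted x = [set t | eval t x = Some (f x)].
  by apply/seteqP; split=> [t []//|t /= tE]; split=> //; rewrite /accepted /= tE.
have -> : Pr A (accepted x) = Pr A [set t | eval t x = Some (f x)]
    + Pr A [set t | eval t x = Some (~~ f x)].
  rewrite /Pr -fineD ?fin_num_measure // -measureU //; last first.
    by apply/seteqP; split=> t //= [->] []; case: (f x).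
  congr (fine (A _)); apply/seteqP; split=> t /=; rewrite /accepted /=.
    case: (eval t x) => [b _|[]//].
    have [->|bf] := eqVneq b (f x); first by left.
    by right; congr Some; case: b (f x) bf => -[].
  by case=> ->.
move=> p0; rewrite ler_pdivlMr //; have := Pr_ge0 [set t | eval t x = Some (~~ f x)].
by move=> q0 h; split; lra.
Qed.

End Probability.

(** * Linear lower and upper bounds for majority *)

Lemma MAJ_post_depth (R : realType) N (A : ralg R N) d : (0 < N)%N ->
  post_computes (1 / 3) (@MAJ N) A ->
  (forall t, in_support A t -> (depth t <= d)%N) -> (N <= 8 * d)%N.
Proof.
move=> N0 Acomp Ad; rewrite leqNgt; apply/negP => dN.
(* The last level on which majority is 0; level [w.+1] is the first on which it is 1. *)
pose w := N./2.
have wN : (N <= w.*2.+1)%N by rewrite /w; lia.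
have wN' : (w.*2 <= N)%N by rewrite /w; lia.
have lo : 2 * level_Pr A (Some true) w <= level_Pr A (Some false) w.
  rewrite mulr_sumr; apply: ler_sum => x /eqP xw.
  by have [] := post_computes_odds x Acomp; rewrite /MAJ xw ltnNge mul2n wN'.
have MAJ_hi x : hamming x == w.+1 -> @MAJ N x = true.
  by move=> /eqP xw; rewrite /MAJ xw; lia.
have hi : 2 * level_Pr A (Some false) w.+1 <= level_Pr A (Some true) w.+1.
  rewrite mulr_sumr; apply: ler_sum => x /MAJ_hi xw.
  by have [] := post_computes_odds x Acomp; rewrite xw.
(* Positivity allows a later cancellation; it needs level [w.+1] to be nonempty, as the input
   starting with [w.+1] ones shows. *)
have pos : 0 < level_Pr A (Some true) w.+1.
  have lt_wN : (w < N)%N by lia.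
  pose x : input N := [ffun i : 'I_N => (i < w.+1)%N].
  have xw : hamming x == w.+1.
    rewrite hammingE -[X in _ == X]card_ord -sum1_card (big_ord_widen N (fun=> 1%N)) //.
    by rewrite [X in _ == X]big_mkcond /=; apply/eqP/eq_bigr => i _; rewrite ffunE; case: ifP.
  rewrite /level_Pr (bigD1 x) //= ltr_pwDl //.
    by have [_] := post_computes_odds x Acomp; rewrite MAJ_hi.
  by apply: sumr_ge0 => y _; exact: Pr_ge0.
have up : level_Pr A (Some false) w * (N - w - d)%:R
    <= level_Pr A (Some false) w.+1 * w.+1%:R.
  apply: level_Pr_mono => t /Ad td; apply: leq_trans (level_count_up _ _ _).
  by rewrite leq_mul2l leq_sub2l ?orbT.
have down : level_Pr A (Some true) w.+1 * (w.+1 - d)%:R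
    <= level_Pr A (Some true) w * (N - w)%:R.
  apply: level_Pr_mono => t /Ad td; apply: leq_trans (level_count_down _ _ _).
  by rewrite leq_mul2l leq_sub2l ?orbT.
set p := level_Pr A (Some true) w.+1 in hi pos down *.
set q := level_Pr A (Some true) w in lo down *.
set r := level_Pr A (Some false) w in lo up *.
set s := level_Pr A (Some false) w.+1 in hi up *.
(* Chain [down], [lo], [up] and [hi] in this order, passing from [p] to [q], [r], [s] and back to
   [p]; [lo] and [hi] give a factor 2 each. *)
have : p * (4 * (N - w - d)%:R * (w.+1 - d)%:R) <= p * ((N - w)%:R * w.+1%:R).
  have nn n : 0 <= n%:R :> R by [].
  have := ler_wpM2r (nn (N - w - d)%N) down.
  have := ler_wpM2r (nn (N - w)%N) up.
  have := ler_wpM2r (mulr_ge0 (nn (N - w)%N) (nn (N - w - d)%N)) lo.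
  have := ler_wpM2r (mulr_ge0 (nn (N - w)%N) (nn w.+1)) hi.
  lra.
(* Since [8 * d < N], both [N - w - d] and [w.+1 - d] exceed 3/4 of [N - w] and [w.+1], so the left
   side is more than 9/4 of the right. *)
rewrite ler_pM2l // -!natrM ler_nat.
nia.
Qed.

Lemma depth_full_tree N f s (y : input N) : depth (full_tree f s y) = size s.
Proof. by elim: s y => //= i s IH y; rewrite !IH maxnn. Qed.

(** The point mass on the tree querying every bit never errs and has depth exactly [N]. *)
Lemma post_complexities_full (R : realType) N (eps : R) (f : input N -> bool) : 0 <= eps ->
  post_complexities eps f N.
Proof.
move=> eps0; pose t := full_tree f (enum 'I_N) [ffun=> false].
have tE x : eval t x = Some (f x).
  rewrite eval_full_tree; congr (Some (f _)); apply/ffunP => j.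
  by rewrite ffunE mem_enum.
have tN : depth t = N by rewrite depth_full_tree size_enum_ord.
pose A : ralg R N := dirac t.
have AE (E : set (dtree N)) : A E = (t \in E)%:R%:E by exact: diracE.
have A1 (E : set (dtree N)) : E t -> A E = 1%E by move=> Et; rewrite AE mem_set.
exists A.
- move=> x; rewrite /cond_Pr /Pr !A1 /accepted /correct /= ?tE //.
  by rewrite ltr01 divr1 lerBlDr lerDl.
- split=> [|u]; first by exists t; rewrite ?/in_support ?A1 // lte_fin.
  rewrite /in_support AE; case: (boolP (t \in [set u])) => [/set_mem <-|].
    by rewrite tN.
  by rewrite ltxx.
Qed.

Lemma PostR_MAJ_bounds (R : realType) N : (0 < N)%N ->
  (N <= 8 * PostR (1 / 3 : R) (@MAJ N) <= 8 * N)%N.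
Proof.
move=> N0; have e0 : 0 <= 1 / 3 :> R by rewrite divr_ge0.
(* [PostR_min] excludes the default value of [get]: the minimum is attained by an actual
   distribution [A]. *)
have [[A Acomp [_ Ad]] lb] := PostR_min (@MAJ N) e0.
by rewrite (MAJ_post_depth N0 Acomp Ad) leq_pmul2l //; exact/lb/post_complexities_full.
Qed.

Theorem theorem3 (R : realType) :
  (fun N : nat => (PostR (1 / 3 : R) (@MAJ N))%:R : R) =Theta_\oo
  (fun N : nat => N%:R : R).
Proof.
(* The constants 1/8 and 1 are those of [PostR_MAJ_bounds]. *)
rewrite eqThetaE qualifE; apply/asboolP; exists (8^-1, 1).
  by apply/andP; split => /=; lra.
near=> N => /=.
have N0 : (0 < N)%N by near: N; exact: nbhs_infty_gt.
have /andP[lb ub] := PostR_MAJ_bounds R N0.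
rewrite !normr_nat; split; first by rewrite ler_pdivrMl // -natrM ler_nat.
by rewrite [leRHS]mul1r ler_nat -(@leq_pmul2l 8).
Unshelve. all: by end_near. Qed.
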